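(* Let $\alpha\in(0,2)$, $a>0$, and let $\sigma:\mathbb{R}^2\times[0,\infty)\to\mathbb{R}$ be a measurable function satisfying the boundedness condition: there is $C$ with $|\sigma(x,t)|\le C$ for all $t\ge0$, $x\in\mathbb{R}^2$. For $x,y\in\mathbb{R}^2$ and $t\ge0$ define \[ G(x,y,t)=\frac{1}{2\pi a}\int_0^{t-\frac{|x-y|}{a}}\frac{\sigma(y,\tau)}{\sqrt{a^2(t-\tau)^2-|y-x|^2}}\,d\tau\;\mathbf{1}_{\{|x-y|<at\}}. \] Then for every $t\ge0$ and $x\in\mathbb{R}^2$ the stochastic integral \[ U(x,t)=\iint_{\mathbb{R}^2}G(x,y,t)\,M(dy) \] with respect to a symmetric $\alpha$-stable random measure $M$ on $\mathbb{R}^2$ with Lebesgue control measure is well defined, i.e. $\iint_{\mathbb{R}^2}|G(x,y,t)|^\alpha\,dy<\infty$.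
   Context: An independently scattered symmetric $\alpha$-stable (S$\alpha$S) random measure $M$ on $\mathbb{R}^2$ with Lebesgue control measure is a random set function on Borel sets $A$ of finite Lebesgue measure $\lambda_2(A)$ such that $M(A)$ is S$\alpha$S with characteristic function $E e^{i\lambda M(A)}=e^{-\lambda_2(A)|\lambda|^\alpha}$, values on disjoint sets are independent, and $M$ is countably additive almost surely. For $f\in L^\alpha(\mathbb{R}^2)$, the integral $\iint f(x)M(dx)$ is defined as the limit in probability of integrals of simple compactly supported functions; it is well defined precisely for $f\in L^\alpha(\mathbb{R}^2)$. *)

(* Defs.v *)
From HB Require Import structures.
From mathcomp Require Import all_boot all_order all_algebra.
From mathcomp Require Import all_classical all_reals all_analysis.
Set Implicit Arguments. Unset Strict Implicit. Unset Printing Implicit Defensive.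
Import Order.TTheory GRing.Theory Num.Theory.
Local Open Scope classical_set_scope.
Local Open Scope ring_scope.

Definition dist2 (R : realType) (x y : R * R) : R :=
  Num.sqrt ((x.1 - y.1) ^+ 2 + (x.2 - y.2) ^+ 2).

Definition leb2 (R : realType) := ((@lebesgue_measure R) \x (@lebesgue_measure R))%E.

Definition Gker (R : realType) (a : R) (sigma : R * R -> R -> R)
    (x y : R * R) (t : R) : R :=
  if dist2 x y < a * t then
    (2 * pi * a)^-1 *
    Rintegral (@lebesgue_measure R) `[0, t - dist2 x y / a]
      (fun tau => sigma y tau /
         Num.sqrt (a ^+ 2 * (t - tau) ^+ 2 - dist2 y x ^+ 2))
  else 0.

(* Main.v *)
Require Import Defs.
From HB Require Import structures.
From mathcomp Require Import all_boot all_order all_algebra.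
From mathcomp Require Import all_classical all_reals all_analysis.
From mathcomp Require Import measurable_realfun ring lra.
Import Order.TTheory GRing.Theory Num.Theory.
Import numFieldNormedType.Exports.
Local Open Scope classical_set_scope.
Local Open Scope ring_scope.

(** With r = |x - y| and d = t - r / a, the radicand factors as
    a (d - tau) (a (d - tau) + 2 r), which is at least a r (d - tau); hence
    |G(x, y, t)| is at most a constant times r^(-1/2), uniformly over the disc
    r < a t outside of which G vanishes.  Since r >= |y_1 - x_1|, the function
    |G|^alpha is dominated by a constant times |y_1 - x_1|^(-alpha/2) on a
    square, and alpha/2 < 1 makes this one-dimensional singularity integrable.
    Measurability of G in y comes from Tonelli's theorem applied to the
    positive and negative parts of the integrand. *)

(** * Improper integrals of power singularities on the line *)

(** The fundamental theorem of calculus on compact subintervals, followed by monotone convergence.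
    Only increments of [F] inside the interval enter, so [f] may blow up at either endpoint. *)
Lemma ge0_integral_oo_le (R : realType) (f F : R -> R) (c d M : R) :
  c < d ->
  (forall u, u \in `]c, d[ -> 0 <= f u) ->
  (forall u, u \in `]c, d[ -> {for u, continuous f}) ->
  (forall u, u \in `]c, d[ -> is_derive u (1 : R) F (f u)) ->
  (forall u v, u \in `]c, d[ -> v \in `]c, d[ -> F v - F u <= M) ->
  (\int[lebesgue_measure]_(u in `]c, d[) (f u)%:E <= M%:E)%E.
Proof.
move=> cd f0 fc Ff FM.
(* The shift by 3 makes the margin at most a third of the length, so [a n < b n] already at
   [n = 0]. *)
pose e n : R := (d - c) / n.+3%:R.
pose a n : R := c + e n.
pose b n : R := d - e n.
have dc0 : 0 < d - c by rewrite subr_gt0.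
have e0 n : 0 < e n by rewrite divr_gt0.
have e3 n : e n <= (d - c) / 3.
  by rewrite ler_pM2l// lef_pV2 ?posrE// ler_nat.
have eh m n : (m <= n)%N -> e n <= e m.
  by move=> mn; rewrite ler_pM2l// lef_pV2 ?posrE// ler_nat !ltnS.
have ca n : c < a n by rewrite ltrDl.
have bd n : b n < d by rewrite gtrBl.
have ab n : a n < b n by rewrite /a /b; have := e3 n; lra.
pose I n : set R := [set` `[a n, b n]].
have Isub n : I n `<=` `]c, d[.
  move=> u; rewrite /I /= !itv_boundlr !bnd_simp => /andP[h1 h2].
  by rewrite (lt_le_trans (ca n))// (le_lt_trans h2).
have Ff' n u : u \in `[a n, b n] -> is_derive u (1 : R) F (f u).
  by move=> uI; apply/Ff/(Isub n).
have fI n : {within I n, continuous f}.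
  apply: continuous_in_subspaceT => u; rewrite inE => uI.
  by apply: fc; exact: (Isub n).
have intI n : (\int[lebesgue_measure]_(u in I n) (f u)%:E =
    (F (b n))%:E - (F (a n))%:E)%E.
  apply: continuous_FTC2; [exact: ab|exact: fI| |].
  - split.
    + move=> u; rewrite in_itv/= => /andP[h1 h2].
      have uI : u \in `[a n, b n] by rewrite in_itv/= !ltW.
      by have := Ff' _ _ uI => ?; exact: ex_derive.
    + have uI : a n \in `[a n, b n] by rewrite in_itv/= lexx ltW.
      have ? := Ff' _ _ uI.
      apply: cvg_at_right_filter; apply: differentiable_continuous.
      by apply/derivable1_diffP; exact: ex_derive.
    + have uI : b n \in `[a n, b n] by rewrite in_itv/= lexx ltW.
      have ? := Ff' _ _ uI.
      apply: cvg_at_left_filter; apply: differentiable_continuous.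
      by apply/derivable1_diffP; exact: ex_derive.
  - move=> u; rewrite in_itv/= => /andP[h1 h2].
    have uI : u \in `[a n, b n] by rewrite in_itv/= !ltW.
    by have ? := Ff' _ _ uI; rewrite derive1E derive_val.
have UI : \bigcup_n I n = `]c, d[%classic.
  apply/seteqP; split => [u [n _] /Isub//|u /=].
  rewrite in_itv/= => /andP[cu ud].
  pose m := Num.min (u - c) (d - u).
  have m0 : 0 < m by rewrite lt_min !subr_gt0 cu.
  (* This index gives [(d - c) / m < n + 1], hence a margin [e n] smaller than the distance [m] from
     [u] to the endpoints. *)
  pose n := Num.trunc ((d - c) / m).
  have : e n <= m.
    rewrite /e ler_pdivrMr// mulrC -ler_pdivrMr//.
    apply/ltW/(lt_le_trans (truncnS_gt _)).
    by rewrite ler_nat ltnS 2?leqW.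
  rewrite le_min => /andP[? ?]; exists n => //; rewrite /I /= !itv_boundlr !bnd_simp.
  by apply/andP; split; rewrite /a /b ?lerBrDr -lerBrDl.
have ndI : nondecreasing_seq I.
  move=> m n mn; apply/subsetPset => u; rewrite /I /= !itv_boundlr !bnd_simp => /andP[h1 h2].
  by rewrite (le_trans _ h1) ?lerD2l ?eh// (le_trans h2)// lerD2l lerN2 eh.
have fm n : measurable_fun (I n) f.
  apply: subspace_continuous_measurable_fun; [exact: measurable_itv|exact: fI].
have H : (\int[lebesgue_measure]_(u in I n) (f u)%:E @[n --> \oo] -->
    \int[lebesgue_measure]_(u in `]c, d[) (f u)%:E)%E.
  rewrite -UI; apply: ge0_nondecreasing_set_cvg_integral => //.
  - by move=> n; exact: measurable_itv.
  - by move=> n; apply/measurable_EFinP; exact: (fm n).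
  - by move=> n u /Isub; exact: f0.
rewrite -(cvg_lim _ H)//; apply: lime_le; first by apply/cvg_ex; eexists; exact: H.
apply: nearW => n.
rewrite [leLHS]intI -EFinB lee_fin; apply: FM; apply: (Isub n) => /=;
  by rewrite /I /= itv_boundlr !bnd_simp ?lexx ?ltW.
Qed.

(** As [e] lies outside the open interval, [u - e] keeps a constant sign there, and the integrand
    has a primitive proportional to [|u - e| ^ (1 - p)]. *)
Lemma integral_normB_powRN_le (R : realType) (p c d e K : R) :
  c < d -> 0 <= p < 1 -> e <= c \/ d <= e ->
  (forall u, u \in `]c, d[ -> `|u - e| <= K) ->
  (\int[lebesgue_measure]_(u in `]c, d[) (`|u - e| `^ (- p))%:E <=
    (K `^ (1 - p) / (1 - p))%:E)%E.
Proof.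
move=> cd /andP[p0 p1] ecd uK.
have q0 : 0 < 1 - p by rewrite subr_gt0.
(* [s] is the sign of [u - e]; carrying it as a factor treats both positions of [e] with one
   primitive. *)
have [s ss su] : exists2 s : R, s * s = 1 &
    forall u, u \in `]c, d[ -> `|u - e| = s * (u - e) /\ 0 < s * (u - e).
  case: ecd => h; [exists 1|exists (-1)]; rewrite ?mulrNN ?mulr1// => u;
    rewrite in_itv/= ?mulN1r ?mul1r ?opprB => /andP[cu ud].
  - have ? : 0 < u - e by lra.
    by rewrite gtr0_norm.
  - have ? : 0 < e - u by lra.
    by rewrite distrC gtr0_norm.
have D q u : u \in `]c, d[ -> is_derive u (1 : R)
    (fun u => (s * (u - e)) `^ q) (q * (s * (u - e)) `^ (q - 1) * s).
  move=> /su[_ h]; have ? := is_derive1_powR q h.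
  apply: (is_derive1_comp (f := @powR R ^~ q) (g := fun u => s * (u - e))).
  by apply: is_derive_eq; rewrite subr0 /GRing.scale/= mulr1.
under eq_integral => u do rewrite inE => /su[-> _].
apply: (@ge0_integral_oo_le _ _ (fun u => s * (1 - p)^-1 * (s * (u - e)) `^ (1 - p))) => //.
- by move=> u _; exact: powR_ge0.
- move=> u ucd; have ? := D (- p) _ ucd.
  by apply: differentiable_continuous; apply/derivable1_diffP; exact: ex_derive.
- move=> u ucd; have ? := D (1 - p) _ ucd.
  apply: is_derive_eq; rewrite /GRing.scale/=.
  rewrite [RHS](_ : _ = (s * s) * ((1 - p)^-1 * (1 - p)) * (s * (u - e)) `^ (1 - p - 1)).
    by ring.
  by rewrite ss mulVf ?gt_eqF// !mul1r; congr (_ `^ _); ring.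
(* Both values of the power lie between 0 and [K ^ (1 - p)], so their difference is at most
   [K ^ (1 - p)] whichever sign [s] gives it. *)
- have h u : u \in `]c, d[ -> 0 <= (s * (u - e)) `^ (1 - p) <= K `^ (1 - p).
    move=> /[dup] /uK uK' /su[uE u0]; rewrite powR_ge0 ge0_ler_powR ?nnegrE//; lra.
  move=> u v /h /andP[? ?] /h /andP[? ?]; rewrite -mulrBr mulrAC ler_pM2r ?invr_gt0//.
  have /orP[] : (s == 1) || (s == -1) by rewrite -sqrf_eq1 expr2 ss.
  all: by move=> /eqP s1; rewrite [X in X * _]s1; lra.
Qed.

(** * Measurability and size of real-valued integrals *)

(** Slices may have infinite integrals: [Rintegral] is [fine] of the extended integral, and [fine]
    is measurable on all extended reals. *)
Lemma measurable_fun_Rintegral d1 d2 (T1 : measurableType d1)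
    (T2 : measurableType d2) (R : realType)
    (mu : {sigma_finite_measure set T2 -> \bar R}) (f : T1 * T2 -> R) :
  measurable_fun setT f ->
  measurable_fun setT (fun x => \int[mu]_y f (x, y)).
Proof.
move=> mf.
have mEf : measurable_fun setT (EFin \o f) by exact/measurable_EFinP.
have -> : (fun x => \int[mu]_y f (x, y)) = fine \o
    (fun x => fubini_F mu (EFin \o f)^\+ x - fubini_F mu (EFin \o f)^\- x)%E.
  apply/funext => x; rewrite /Rintegral integralE /= /fubini_F.
  by congr (fine (_ - _)%E); apply: eq_integral => y _; rewrite ?funeposE ?funenegE.
apply: measurableT_comp; first exact: fine_measurable.
apply: emeasurable_funB; apply: measurable_fun_fubini_tonelli_F => //.
- exact: measurable_funepos.
- exact: measurable_funeneg.
Qed.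

(** The triangle inequality holds for the extended integral; the finite bound [B] then excludes the
    infinite values, which [fine] would turn into 0. *)
Lemma normr_Rintegral_le d (T : measurableType d) (R : realType)
    (mu : {measure set T -> \bar R}) (f : T -> R) (B : R) :
  measurable_fun setT f ->
  (\int[mu]_x `|f x|%:E <= B%:E)%E -> `|\int[mu]_x f x| <= B.
Proof.
move=> mf fB.
have mEf : measurable_fun setT (EFin \o f) by exact/measurable_EFinP.
have := le_trans (le_abse_integral mu measurableT mEf) fB.
rewrite /Rintegral /comp; case: (integral _ _ _) => [r||]//=;
  by rewrite ?lee_fin// leye_eq.
Qed.

(** * The planar distance and measurability of the kernel *)

Lemma dist2C (R : realType) (x y : R * R) : dist2 x y = dist2 y x.
Proof. by rewrite /dist2; congr Num.sqrt; ring. Qed.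

Lemma measurable_sqrt (R : realType) : measurable_fun setT (@Num.sqrt R).
Proof. by apply: continuous_measurable_fun; exact: sqrt_continuous. Qed.

Lemma measurable_dist2 (R : realType) (x : R * R) : measurable_fun setT (dist2 x).
Proof.
apply: (measurableT_comp (@measurable_sqrt R)).
apply: measurable_funD; apply: measurable_funX; apply: measurable_funB => //.
Qed.

Lemma norm_fst_le_dist2 (R : realType) (x y : R * R) : `|y.1 - x.1| <= dist2 x y.
Proof. by rewrite distrC -sqrtr_sqr ler_wsqrtr// lerDl sqr_ge0. Qed.

Lemma norm_snd_le_dist2 (R : realType) (x y : R * R) : `|y.2 - x.2| <= dist2 x y.
Proof. by rewrite distrC -sqrtr_sqr ler_wsqrtr// lerDr sqr_ge0. Qed.

(** The integrand of [Gker] extended by 0 to all times. The inverse is written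
    as the power -1, whose measurability is in the library; at the endpoint
    tau = t - r / a, where the root vanishes, both are 0. *)
Definition Gker_integrand {R : realType} (a : R) (sigma : R * R -> R -> R)
    (x : R * R) (t : R) (p : (R * R) * R) : R :=
  if [&& dist2 x p.1 < a * t, 0 <= p.2 & p.2 <= t - dist2 x p.1 / a] then
    sigma p.1 p.2 * Num.sqrt (a ^+ 2 * (t - p.2) ^+ 2 - dist2 x p.1 ^+ 2) `^ (- 1)
  else 0.

(** Moving the [y]-dependent time domain into the integrand leaves an integral over the whole line,
    the form to which Tonelli applies. *)
Lemma GkerE (R : realType) (a : R) (sigma : R * R -> R -> R) x y t :
  Gker a sigma x y t = (2 * pi * a)^-1 *
    \int[@lebesgue_measure R]_tau Gker_integrand a sigma x t (y, tau).
Proof.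
rewrite /Gker; case: ifPn => xyt; last first.
  rewrite (_ : Rintegral _ _ _ = 0) ?mulr0// /Rintegral.
  under eq_integral do rewrite /Gker_integrand/= (negPf xyt)/=.
  by rewrite integral0.
rewrite [in LHS]Rintegral_mkcond; congr (_ * Rintegral _ _ _).
apply/funext => tau; rewrite /Gker_integrand /= xyt /=.
rewrite patchE mem_setE/= in_itv/= dist2C.
by case: ifPn => // _; rewrite powR_inv1.
Qed.

Lemma measurable_Gker_integrand (R : realType) (a : R)
    (sigma : R * R -> R -> R) (x : R * R) (t : R) :
  measurable_fun [set p : (R * R) * R | 0 <= p.2]
    (fun p : (R * R) * R => sigma p.1 p.2) ->
  measurable_fun setT (Gker_integrand a sigma x t).
Proof.
move=> msigma.
have md : measurable_fun setT (fun p : (R * R) * R => dist2 x p.1).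
  by apply: (measurableT_comp (measurable_dist2 _ x)).
have mp2 : measurable_fun setT (fun p : (R * R) * R => p.2) by exact: measurable_snd.
have mcond : measurable_fun setT (fun p : (R * R) * R =>
    [&& dist2 x p.1 < a * t, 0 <= p.2 & p.2 <= t - dist2 x p.1 / a]).
  apply: measurable_and; first exact: measurable_fun_ltr.
  apply: measurable_and; first exact: measurable_fun_ler.
  apply: measurable_fun_ler => //; apply: measurable_funB => //.
  exact: measurable_funM.
apply: measurable_fun_if => //; rewrite setTI.
apply: measurable_funM.
  (* The condition contains [0 <= p.2], so [sigma] is evaluated only on the set where it is assumed
     measurable. *)
  apply: measurable_funS msigma.
    rewrite (_ : mkset _ =
        setT `&` (fun p : (R * R) * R => 0 <= p.2) @^-1` [set true]).
      by apply: measurable_fun_ler.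
    by rewrite setTI.
  by move=> p /= /and3P[].
apply: measurable_funTS.
apply: (measurableT_comp (@measurable_powR R (-1))).
apply: (measurableT_comp (@measurable_sqrt R)).
apply: measurable_funB; last exact: measurable_funX.
apply: measurable_funM => //; apply: measurable_funX; exact: measurable_funB.
Qed.

Lemma measurable_Gker (R : realType) (a : R)
    (sigma : R * R -> R -> R) (x : R * R) (t : R) :
  measurable_fun [set p : (R * R) * R | 0 <= p.2]
    (fun p : (R * R) * R => sigma p.1 p.2) ->
  measurable_fun setT (fun y => Gker a sigma x y t).
Proof.
move=> msigma; under eq_fun do rewrite GkerE.
apply: measurable_funM => //.
apply: (@measurable_fun_Rintegral _ _ _ _ R (@lebesgue_measure R)
  (Gker_integrand a sigma x t)).
exact: measurable_Gker_integrand.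
Qed.

(** * Pointwise bounds on the integrand and on the kernel *)

(** The radicand is bounded below with [|y.1 - x.1|] in place of the distance, so that the spatial
    singularity involves one coordinate only. Starting the time interval at -1 puts [tau = 0] inside
    an open interval. *)
Lemma Gker_integrand_le (R : realType) (a C : R) (sigma : R * R -> R -> R)
    (x y : R * R) (t tau : R) :
  0 < a -> (forall (s : R) z, 0 <= s -> `|sigma z s| <= C) -> y.1 != x.1 ->
  `|Gker_integrand a sigma x t (y, tau)| <=
    ((fun s => C * (Num.sqrt (a * `|y.1 - x.1|))^-1 *
      `|s - (t - dist2 x y / a)| `^ (- 2^-1))
      \_ `]-1, t - dist2 x y / a[) tau.
Proof.
move=> a0 sigmaC yx.
have C0 : 0 <= C by apply: le_trans (sigmaC 0 x (lexx _)).
have rhs0 s : 0 <= C * (Num.sqrt (a * `|y.1 - x.1|))^-1 *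
      `|s - (t - dist2 x y / a)| `^ (- 2^-1).
  by rewrite mulr_ge0 ?powR_ge0// mulr_ge0// invr_ge0 sqrtr_ge0.
rewrite /Gker_integrand/=; case: ifPn => [/and3P[xyt tau0]|_]; last first.
  by rewrite normr0 patchE; case: ifPn.
set r := dist2 x y; set d := t - r / a => taud.
have ur := norm_fst_le_dist2 _ x y; rewrite -/r in ur.
have u0 : 0 < `|y.1 - x.1| by rewrite normr_gt0 subr_eq0.
move: u0 ur; set u := `|y.1 - x.1| => u0 ur.
have rE : r = a * (t - d) by rewrite /d; field; rewrite gt_eqF.
have factor : a ^+ 2 * (t - tau) ^+ 2 - r ^+ 2 =
    a * (d - tau) * (a * (d - tau) + 2 * r) by rewrite rE; ring.
(* The endpoint lies outside the interval of the majorant; the inequality holds there because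
   [0 ^ (-1)] is 0 for [powR]. *)
have [->|taud'] := eqVneq tau d.
  rewrite rE (_ : _ - _ = 0); last by ring.
  by rewrite sqrtr0 powR0 ?mulr0 ?normr0 ?patchE; [case: ifPn|lra].
have dtau : 0 < d - tau by rewrite subr_gt0 lt_neqAle taud'.
rewrite patchE mem_setE ifT; last first.
  rewrite /= in_itv/= -[tau < d]subr_gt0 dtau andbT.
  by rewrite (lt_le_trans _ tau0)// ltrN10.
rewrite normrM -mulrA; apply: ler_pM => //; first exact: sigmaC.
rewrite factor distrC (gtr0_norm dtau) (powRN (d - tau)) powR12_sqrt; last exact: ltW.
rewrite powR_inv1 ?sqrtr_ge0// ger0_norm ?invr_ge0 ?sqrtr_ge0//.
rewrite -invfM -sqrtrM; last by rewrite mulr_ge0 ?ltW.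
rewrite lef_pV2 ?posrE ?sqrtr_gt0 ?mulr_gt0//; last by nra.
apply: ler_wsqrtr.
(* Cancelling [a * (d - tau)] leaves [u <= a * (d - tau) + 2 * r], which follows from
   [0 < u <= r]. *)
rewrite mulrAC ler_pM2l ?mulr_gt0//.
have : 0 < a * (d - tau) by rewrite mulr_gt0.
lra.
Qed.

Lemma Gker_le (R : realType) (a C : R) (sigma : R * R -> R -> R)
    (x y : R * R) (t : R) :
  0 < a -> 0 <= t ->
  measurable_fun [set p : (R * R) * R | 0 <= p.2]
    (fun p : (R * R) * R => sigma p.1 p.2) ->
  (forall (s : R) z, 0 <= s -> `|sigma z s| <= C) -> y.1 != x.1 ->
  `|Gker a sigma x y t| <= (2 * pi * a)^-1 *
    (C * (Num.sqrt (a * `|y.1 - x.1|))^-1 * ((t + 1) `^ (1 - 2^-1) / (1 - 2^-1))).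
Proof.
move=> a0 t0 msigma sigmaC yx.
have C0 : 0 <= C by apply: le_trans (sigmaC 0 x (lexx _)).
have pia : 0 < 2 * pi * a :> R by rewrite !mulr_gt0// pi_gt0.
have [xyt|xyt] := ltP (dist2 x y) (a * t); last first.
  rewrite /Gker ltNge xyt normr0; apply: mulr_ge0.
    by rewrite invr_ge0 ltW.
  by rewrite !mulr_ge0 ?invr_ge0 ?sqrtr_ge0 ?powR_ge0//; lra.
rewrite GkerE normrM gtr0_norm ?invr_gt0// ler_pM2l ?invr_gt0//.
have mphi : measurable_fun setT (fun tau => Gker_integrand a sigma x t (y, tau)).
  apply: (measurableT_comp (measurable_Gker_integrand _ a sigma x t msigma)).
  exact: pair1_measurable.
apply: normr_Rintegral_le => //.
set d := t - dist2 x y / a; set K := C * _.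
have K0 : 0 <= K by rewrite /K mulr_ge0// invr_ge0 sqrtr_ge0.
have d0 : 0 < d by rewrite subr_gt0 ltr_pdivrMr// mulrC.
have dt : d <= t by rewrite gerBl divr_ge0 ?sqrtr_ge0//; exact: ltW.
pose D := `]-1, d[%classic : set R.
pose g (s : R) := `|s - d| `^ (- 2^-1).
have mg : measurable_fun setT g.
  apply: (measurableT_comp (@measurable_powR R _)).
  by apply: measurableT_comp => //; apply: measurable_funB.
have mD : measurable D by exact: measurable_itv.
apply: (@le_trans _ _
    (\int[lebesgue_measure]_tau ((fun s => K%:E * (g s)%:E) \_ D) tau)%E).
  apply: ge0_le_integral => //.
  - by apply/measurable_EFinP; exact: measurableT_comp.
  - apply/(measurable_restrictT _ _).1 => //.
    by apply/measurable_funTS; apply: measurable_funeM; exact/measurable_EFinP.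
  - move=> tau _; have := @Gker_integrand_le R a C sigma x y t tau a0 sigmaC yx.
    by rewrite -/d -/K -/D !patchE; case: ifPn => _; rewrite lee_fin.
rewrite -integral_mkcond ge0_integralZl//; last 2 first.
- by apply/measurable_funTS/measurable_EFinP.
- by move=> s _; rewrite lee_fin powR_ge0.
rewrite [leRHS]EFinM. apply: lee_wpmul2l; first by rewrite lee_fin.
(* The singularity sits at the right end [d] with exponent 1/2. Distances to [d] stay below
   [d + 1 <= t + 1], whence the constant. *)
apply: integral_normB_powRN_le.
- by rewrite (lt_trans _ d0)// ltrN10.
- by apply/andP; split; lra.
- by right.
- by move=> u; rewrite in_itv/= => /andP[? ?]; rewrite distrC gtr0_norm; lra.
Qed.

(** * Integrability over the plane and conclusion *)

(** The line y_1 = x_1, where the bound is not assumed, is negligible. *)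
Lemma leb2_integral_lty (R : realType) (f : R * R -> R) (x : R * R)
    (p A L : R) :
  measurable_fun setT f -> (forall y, 0 <= f y) -> 0 <= p < 1 -> 0 < L ->
  (forall y, y.1 != x.1 -> f y <= A * `|y.1 - x.1| `^ (- p)) ->
  (forall y, L <= `|y.1 - x.1| -> f y = 0) ->
  (forall y, L <= `|y.2 - x.2| -> f y = 0) ->
  (\int[@leb2 R]_y (f y)%:E < +oo)%E.
Proof.
move=> mf f0 p01 L0 fA fL1 fL2.
have A0 : 0 <= A.
  (* At first-coordinate distance 1 the bound reads [f y <= A]. *)
  have := fA (x.1 + 1, x.2); rewrite /= gt_eqF ?ltrDl// => /(_ isT).
  rewrite (_ : x.1 + 1 - x.1 = 1); last by ring.
  by rewrite normr1 powR1 mulr1; exact: le_trans.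
have mEf : measurable_fun setT (EFin \o f) by exact/measurable_EFinP.
rewrite (@fubini_tonelli1 _ _ _ _ R (@lebesgue_measure R)
  (@lebesgue_measure R) (EFin \o f) mEf)//.
set F := fubini_F _ _.
have mF : measurable_fun setT F by exact: measurable_fun_fubini_tonelli_F.
have F0 u : (0 <= F u)%E by apply: integral_ge0 => v _; rewrite lee_fin.
pose h (u : R) := `|u - x.1| `^ (- p).
have mh : measurable_fun setT (EFin \o h).
  apply/measurable_EFinP; apply: (measurableT_comp (@measurable_powR R _)).
  by apply: measurableT_comp => //; apply: measurable_funB.
have h0 u : (0 <= (h u)%:E)%E by rewrite lee_fin powR_ge0.
have Fh (u : R) : u != x.1 -> (F u <= (2 * L * A)%:E * (h u)%:E)%E.
  move=> ux.
  (* On a vertical slice [f] is at most the constant [A * h u] and vanishes off [D], whose length is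
     [2 * L]. *)
  pose D := `]x.2 - L, x.2 + L[%classic : set R.
  have mD : measurable D by exact: measurable_itv.
  apply: (@le_trans _ _ (\int[@lebesgue_measure R]_v ((cst (A * h u)%:E \_ D) v))%E).
    apply: ge0_le_integral => //.
    - by move=> v _; rewrite lee_fin.
    - by apply/measurable_EFinP; apply: (measurableT_comp mf); exact: pair1_measurable.
    - apply/(measurable_restrictT _ _).1 => //.
      move=> v _; rewrite patchE; case: ifPn => [_|vD].
        by rewrite lee_fin; exact: (fA (u, v)).
      rewrite /= fL2//= leNgt ltr_norml; apply: contra vD => /andP[? ?].
      by rewrite mem_setE/= in_itv/=; apply/andP; split; lra.
  rewrite -[leRHS]EFinM -(mulrA (2 * L)) [leRHS]EFinM.
  have -> : (2 * L)%:E = lebesgue_measure D.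
    by rewrite lebesgue_measure_itv/= lte_fin ifT -?EFinD; [congr EFin; ring|lra].
  by rewrite -integral_mkcond integral_cst// muleC.
(* The support is cut at the singularity, so that it becomes an endpoint of each half. *)
pose I1 := `]x.1 - L, x.1[%classic : set R.
pose I2 := `]x.1, x.1 + L[%classic : set R.
have mI1 : measurable I1 by exact: measurable_itv.
have mI2 : measurable I2 by exact: measurable_itv.
pose H (u : R) := ((2 * L * A)%:E * (h u)%:E)%E.
have LA0 : 0 <= 2 * L * A by rewrite mulr_ge0//; lra.
have H0 u : (0 <= H u)%E by rewrite mule_ge0.
have mH : measurable_fun setT H by exact: measurable_funeM.
have IH I : measurable I -> (\int[lebesgue_measure]_(u in I) (h u)%:E < +oo)%E ->
    (\int[lebesgue_measure]_(u in I) H u < +oo)%E.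
  move=> mI hI; rewrite /H ge0_integralZl//; last exact: measurable_funTS.
  by rewrite lte_mul_pinfty.
have h_lty (c d : R) : c < d -> x.1 <= c \/ d <= x.1 ->
    (\int[lebesgue_measure]_(u in `]c, d[) (h u)%:E < +oo)%E.
  (* A crude bound on [|u - x.1|] suffices, since only finiteness is claimed. *)
  move=> cd ecd; pose K := `|c - x.1| + `|d - x.1|.
  apply: (@le_lt_trans _ _ (K `^ (1 - p) / (1 - p))%:E); last exact: ltry.
  apply: integral_normB_powRN_le => // u; rewrite in_itv/= => /andP[? ?].
  rewrite ler_norml /K; apply/andP; split.
    by rewrite lerNl; have := ler_norm (- (c - x.1)); have := normr_ge0 (d - x.1);
      rewrite normrN; lra.
  by have := ler_norm (d - x.1); have := normr_ge0 (c - x.1); lra.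
have mHI I : measurable I -> measurable_fun setT (H \_ I).
  by move=> mI; apply/(measurable_restrictT _ _).1 => //; exact: measurable_funTS.
have HI0 I u : (0 <= (H \_ I) u)%E by rewrite patchE; case: ifPn.
have mx : measurable (setT `\ x.1 : set R) by apply: measurableD.
(* At [u = x.1] with [p > 0], [powR] gives [h u = 0], so [H] need not dominate [F] there; this null
   point is deleted first. *)
rewrite -(@integral_setD1 R F x.1 setT)//; last exact: measurable_funTS.
apply: (@le_lt_trans _ _
   (\int[@lebesgue_measure R]_u ((H \_ I1) u + (H \_ I2) u))%E).
  apply: (@le_trans _ _
     (\int[@lebesgue_measure R]_(u in setT `\ x.1) ((H \_ I1) u + (H \_ I2) u))%E).
    apply: ge0_le_integral => //.
    - exact: measurable_funTS.
    - by apply: measurable_funTS; apply: emeasurable_funD; exact: mHI.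
    - move=> u [_ /eqP ux]; have [Lu|Lu] := leP L `|u - x.1|.
        rewrite (_ : F u = 0) ?adde_ge0//.
        by apply: integral0_eq => v _ /=; rewrite fL1.
      move: Lu; rewrite ltr_norml => /andP[Lu1 Lu2].
      rewrite !patchE !mem_setE/= !in_itv/=.
      have [xu|xu|xu] := ltgtP u x.1; last by rewrite xu eqxx in ux.
      - by rewrite ifT ?adde0 ?Fh//; lra.
      - by rewrite ifF ?add0e ?ifT ?Fh//; lra.
  apply: ge0_subset_integral => //.
  - by apply: emeasurable_funD; exact: mHI.
  - by move=> u _; rewrite adde_ge0.
rewrite ge0_integralD//; [|exact: mHI..].
by rewrite -!integral_mkcond lte_add_pinfty// IH// h_lty//; lra.
Qed.

Theorem theorem1 (R : realType) (alpha a : R) (sigma : R * R -> R -> R)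
  (halpha : 0 < alpha < 2) (ha : 0 < a)
  (hmeas : measurable_fun [set p : (R * R) * R | 0 <= p.2]
             (fun p : (R * R) * R => sigma p.1 p.2))
  (hbound : exists C : R, forall (t : R) (x : R * R), 0 <= t -> `|sigma x t| <= C) :
  forall (t : R) (x : R * R), 0 <= t ->
    measurable_fun setT (fun y : R * R => Gker a sigma x y t) /\
    (\int[@leb2 R]_(y in setT) ((`|Gker a sigma x y t| `^ alpha)%:E) < +oo)%E.
Proof.
move=> t x t0.
have mG := measurable_Gker _ a sigma x t hmeas.
split; first exact: mG.
have [C sigmaC] := hbound.
have /andP[alpha0 alpha2] := halpha.
have C0 : 0 <= C by apply: le_trans (sigmaC 0 x (lexx _)).
(* Splitting the root of [a * |y.1 - x.1|] isolates the singular factor and leaves a constant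
   independent of [y]. *)
have [K K0 GK] : exists2 K : R, 0 <= K & forall y, y.1 != x.1 ->
    `|Gker a sigma x y t| <= K * `|y.1 - x.1| `^ (- 2^-1).
  exists ((2 * pi * a)^-1 *
    (C * (Num.sqrt a)^-1 * ((t + 1) `^ (1 - 2^-1) / (1 - 2^-1)))) => [|y yx].
    rewrite !mulr_ge0 ?invr_ge0 ?mulr_ge0 ?sqrtr_ge0 ?powR_ge0 ?pi_ge0 ?(ltW ha)//.
    by lra.
  apply: le_trans (Gker_le _ _ _ _ _ _ _ ha t0 hmeas sigmaC yx) _.
  rewrite sqrtrM ?(ltW ha)// powRN powR12_sqrt// [X in C * X]invfM le_eqVlt.
  by apply/orP; left; apply/eqP; ring.
have at0 : 0 <= a * t by rewrite mulr_ge0// ltW.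
(* The added 1 keeps the half-width of the square positive when [t = 0]. Since [alpha] is nonzero,
   [0 ^ alpha] is 0. *)
have Gk0 y : a * t + 1 <= dist2 x y -> `|Gker a sigma x y t| `^ alpha = 0.
  move=> aty; rewrite /Gker ifF ?normr0 ?powR0//; first by rewrite gt_eqF.
  by apply/negbTE; rewrite -leNgt (le_trans _ aty)// lerDl.
(* Raising the bound to the power [alpha] turns the exponent 1/2 into [alpha / 2], which is below 1
   exactly because [alpha < 2]. *)
apply: (@leb2_integral_lty R _ x (alpha / 2) (K `^ alpha) (a * t + 1)).
- apply: (measurableT_comp (@measurable_powR R alpha)).
  exact: measurableT_comp.
- by move=> y; exact: powR_ge0.
- by apply/andP; split; lra.
- by rewrite ltr_wpDl.
- move=> y yx.
  have u0 := normr_ge0 (y.1 - x.1).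
  rewrite (_ : - (alpha / 2) = - 2^-1 * alpha); last by ring.
  rewrite powRrM -powRM// ?powR_ge0//.
  by rewrite ge0_ler_powR ?nnegrE ?mulr_ge0 ?powR_ge0 ?(ltW alpha0) ?GK.
- by move=> y yL; apply: Gk0; exact: le_trans yL (norm_fst_le_dist2 _ x y).
- by move=> y yL; apply: Gk0; exact: le_trans yL (norm_snd_le_dist2 _ x y).
Qed.
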